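(* Let $(\Omega,d)$ be a compact metric space, $T:\Omega\to\Omega$ a continuous map with $h_{\mathrm{top}}(T,\Omega)<\infty$, and let $\nu$ be a Borel probability measure on $\Omega$ (not necessarily $T$-invariant) which is Ahlfors-Bowen with parameter $h=h_{\mathrm{top}}(T,\Omega)$. Let $X=\{X_n\}_{n\ge 1}$ be a sequence of real-valued random variables on $\Omega$ (not assumed continuous) satisfying the weak Bowen condition. For $q\in\mathbb{R}$ put $$\phi_X(q)=\limsup_{n\to\infty}\frac1n\log\int_\Omega e^{qX_n}\,d\nu,$$ and let $\phi_X^*(\alpha)=\sup_{q\in\mathbb{R}}\{\alpha q-\phi_X(q)\}$ be its Legendre-Fenchel transform. Then for all $\alpha\in\mathcal{L}_X$, $$h_{\mathrm{top}}(T,K_\alpha)\le h_{\mathrm{top}}(T,\Omega)-\phi_X^*(\alpha).$$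
   Context: Random variables on $\Omega$ are Borel measurable functions. For $\alpha\in\mathbb{R}$, $K_\alpha=\{x\in\Omega:\lim_{n\to\infty}\frac1nX_n(x)=\alpha\}$ and $\mathcal{L}_X=\{\alpha\in\mathbb{R}:K_\alpha\ne\emptyset\}$. Bowen metric and balls: for $n\in\mathbb{N}=\{1,2,\dots\}$, $d_n(x,y)=\max_{0\le i\le n-1}d(T^ix,T^iy)$ and $B_n(x,\varepsilon)=\{y\in\Omega:d_n(x,y)<\varepsilon\}$. Topological entropy (Bowen) of an arbitrary subset $Z\subset\Omega$: for $t\in\mathbb{R}$, $\varepsilon>0$, $N\in\mathbb{N}$ let $$m(Z,t,\varepsilon,N)=\inf\Big\{\sum_{i=1}^\infty e^{-n_it}:Z\subset\bigcup_{i=1}^\infty B_{n_i}(x_i,\varepsilon),\ n_i\ge N\Big\}$$ (with $m(\emptyset,t,\varepsilon,N)=0$), $m(Z,t,\varepsilon)=\lim_{N\to\infty}m(Z,t,\varepsilon,N)$, $h_{\mathrm{top}}(T,Z,\varepsilon)=\inf\{t\in\mathbb{R}:m(Z,t,\varepsilon)=0\}$, and $h_{\mathrm{top}}(T,Z)=\lim_{\varepsilon\to0+}h_{\mathrm{top}}(T,Z,\varepsilon)$; by convention $h_{\mathrm{top}}(T,\emptyset)=-\infty$. A Borel probability measure $m$ on $\Omega$ is Ahlfors-Bowen with parameter $h>0$ if for every $\varepsilon>0$ there is a finite constant $C(\varepsilon)>0$ such that for every $n\ge1$ and all $\omega\in\Omega$, $\frac{1}{C(\varepsilon)}e^{-nh}\le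 m(B_n(\omega,\varepsilon))\le C(\varepsilon)e^{-nh}$. For $H:\Omega\to\mathbb{R}$, $v_{n,\delta}(H)=\sup_{d_n(y,z)\le\delta}|H(y)-H(z)|$. The sequence $\{X_n\}$ satisfies the weak Bowen condition if there exists $\delta>0$ such that $\lim_{n\to\infty}\frac{v_{n,\delta}(X_n)}{n}=0$. The functions $\phi_X$ and $\phi_X^*$ may take values in $\mathbb{R}\cup\{\pm\infty\}$. *)

(* Defs.v *)
From HB Require Import structures.
From mathcomp Require Import all_boot all_order all_algebra.
From mathcomp Require Import all_classical all_reals all_analysis.

Set Implicit Arguments.
Unset Strict Implicit.
Unset Printing Implicit Defensive.

Import Order.TTheory GRing.Theory Num.Theory.
Import numFieldNormedType.Exports.

Local Open Scope classical_set_scope.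
Local Open Scope ring_scope.

(* A [measurableType] is pointed, so the Borel sigma-algebra can only be put on
   a metric space with a distinguished point. The point plays no role; a space
   carrying a probability measure is nonempty anyway. *)
#[short(type="pointedMetricType")]
HB.structure Definition PointedMetric (K : numDomainType) :=
  {M of Metric K M & Pointed M}.

Notation borel Omega := (g_sigma_algebraType (@open Omega)).

Section bowen.
Context {R : realType} {Omega : metricType R} (T : Omega -> Omega).

Definition bowen_dist (n : nat) (x y : Omega) : R :=
  \big[Num.max/0]_(i < n) mdist (iter i T x) (iter i T y).

Definition bowen_ball (n : nat) (x : Omega) (eps : R) : set Omega :=
  [set y | bowen_dist n x y < eps].

Definition bowen_cover (Z : set Omega) (eps : R) (N : nat)
    (k : nat -> nat) (x : nat -> Omega) : Prop :=
  (forall i, (N <= k i)%N) /\ Z `<=` \bigcup_i bowen_ball (k i) (x i) eps.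

(* The empty set is treated apart because covers are infinite sequences: for
   t <= 0 every one of them has infinite weight. *)
Definition bowen_premeasure (Z : set Omega) (t eps : R) (N : nat) : \bar R :=
  if `[< Z = set0 >] then 0%E else
  ereal_inf [set w | exists k x, bowen_cover Z eps N k x /\
    w = (\sum_(0 <= i <oo) (expR (- ((k i)%:R * t)))%:E)%E].

(* The limit exists: see [is_cvg_bowen_premeasure]. *)
Definition bowen_measure (Z : set Omega) (t eps : R) : \bar R :=
  limn (bowen_premeasure Z t eps).

Definition htop_eps (Z : set Omega) (eps : R) : \bar R :=
  ereal_inf [set t%:E | t in [set t : R | bowen_measure Z t eps = 0%E]].

(* The limit exists: see [is_cvg_htop_eps]. The value at [set0] is [-oo]: see
   [htop0]. *)
Definition htop (Z : set Omega) : \bar R :=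
  lim (htop_eps Z eps @[eps --> 0^'+]).

Definition variation (n : nat) (delta : R) (H : Omega -> R) : \bar R :=
  ereal_sup [set r | exists y z, bowen_dist n y z <= delta /\
                                 r = `|H y - H z|%:E].

(* Sequences of random variables are indexed by [nat], but only the indices
   n >= 1 are meaningful: the term at 0 affects none of the limits below. *)
Definition weak_bowen (X : nat -> Omega -> R) : Prop :=
  exists2 delta : R, 0 < delta &
    (n%:R^-1%:E * variation n delta (X n))%E @[n --> \oo] --> (0%E : \bar R).

Lemma bowen_premeasure_nd Z t eps : nondecreasing_seq (bowen_premeasure Z t eps).
Proof.
move=> N M NM; rewrite /bowen_premeasure; case: ifPn => // _.
apply: ereal_inf_le_tmp => _ [k [x [[Nk Zk] ->]]].
by exists k, x; split=> //; split=> // i; exact: leq_trans (Nk i).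
Qed.

Lemma is_cvg_bowen_premeasure Z t eps : cvgn (bowen_premeasure Z t eps).
Proof. exact/ereal_nondecreasing_is_cvgn/bowen_premeasure_nd. Qed.

Lemma bowen_premeasure_ge0 Z t eps N : (0 <= bowen_premeasure Z t eps N)%E.
Proof.
rewrite /bowen_premeasure; case: ifPn => // _.
apply: le_ereal_inf_tmp => _ [k [x [_ ->]]].
by apply: nneseries_ge0 => i _ _; rewrite lee_fin expR_ge0.
Qed.

Lemma bowen_premeasure_eps Z t eps eps' N : eps <= eps' ->
  (bowen_premeasure Z t eps' N <= bowen_premeasure Z t eps N)%E.
Proof.
move=> ee'; rewrite /bowen_premeasure; case: ifPn => // _.
apply: ereal_inf_le_tmp => _ [k [x [[Nk Zk] ->]]].
exists k, x; split=> //; split=> // z /Zk[i _ zi]; exists i => //.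
exact: lt_le_trans ee'.
Qed.

Lemma htop_eps_ni Z eps eps' : eps <= eps' -> (htop_eps Z eps' <= htop_eps Z eps)%E.
Proof.
move=> ee'; apply: ereal_inf_le_tmp => _ [t /= Z0 <-]; exists t => //=.
apply/eqP; rewrite eq_le; apply/andP; split.
  rewrite -Z0; apply: lee_lim; [exact: is_cvg_bowen_premeasure..|].
  by apply: nearW => N; exact: bowen_premeasure_eps.
apply: lime_ge; first exact: is_cvg_bowen_premeasure.
by apply: nearW => N; exact: bowen_premeasure_ge0.
Qed.

Lemma is_cvg_htop_eps Z : cvg (htop_eps Z eps @[eps --> 0^'+]).
Proof.
apply: nonincreasing_at_right_is_cvge; apply: nearW => b x y _ _.
exact: htop_eps_ni.
Qed.

Lemma htop0 : htop set0 = -oo%E.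
Proof.
rewrite /htop (_ : htop_eps set0 = cst -oo%E) ?lim_cst//.
apply/funext => eps /=; rewrite -(ereal_inf_real R); congr ereal_inf.
apply/seteqP; split=> [_ [t _ <-]|_ [t _ <-]]; exists t => //=.
rewrite /bowen_measure (_ : bowen_premeasure set0 t eps = cst 0%E) ?lim_cst//.
by apply/funext => N; rewrite /bowen_premeasure asboolT.
Qed.

End bowen.

Section large_deviations.
Context {R : realType} {Omega : pointedMetricType R}.

(* The conjunct [0 < h] also makes [ahlfors_bowen T m (fine (htop T setT))] fail
   when [htop T setT] is infinite, since [fine] then returns 0. *)
Definition ahlfors_bowen (T : Omega -> Omega)
    (m : probability (borel Omega) R) (h : R) : Prop :=
  0 < h /\ forall eps : R, 0 < eps -> exists2 C : R, 0 < C &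
    forall (n : nat) (w : Omega), (1 <= n)%N ->
      ((C^-1 * expR (- (n%:R * h)))%:E <= m (bowen_ball T n w eps))%E /\
      (m (bowen_ball T n w eps) <= (C * expR (- (n%:R * h)))%:E)%E.

Definition level_set (X : nat -> Omega -> R) (alpha : R) : set Omega :=
  [set x | n%:R^-1 * X n x @[n --> \oo] --> alpha].

Definition spectrum (X : nat -> Omega -> R) : set R :=
  [set alpha | level_set X alpha !=set0].

(* The integral may be [+oo], in which case so is its logarithm [lne]. *)
Definition free_energy (nu : probability (borel Omega) R)
    (X : nat -> Omega -> R) (q : R) : \bar R :=
  limn_esup (fun n =>
    (n%:R^-1%:E * lne (\int[nu]_x (expR (q * X n x))%:E))%E).

End large_deviations.

Definition legendre {R : realType} (phi : R -> \bar R) (alpha : R) : \bar R :=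
  ereal_sup (range (fun q : R => ((alpha * q)%:E - phi q)%E)).

(* Main.v *)
Require Import Defs.
From mathcomp Require Import all_boot all_order all_algebra.
From mathcomp Require Import all_classical all_reals all_analysis.
From mathcomp Require Import measurable_realfun ring lra.

Set Implicit Arguments.
Unset Strict Implicit.
Unset Printing Implicit Defensive.

Import Order.TTheory GRing.Theory Num.Theory.
Import numFieldNormedType.Exports.
Local Open Scope classical_set_scope.
Local Open Scope ring_scope.

(** Fix [q] and a real [r] above the free energy at [q]. For large [n] let
    [A_n] be the set of points where [X_n] is within [n * eta] of [n * alpha],
    and take a maximal [(n, eps)]-separated subset of [A_n]. The half-radius
    Bowen balls around its points are disjoint; each has mass at least
    [C^-1 * exp (- n h)] by the Ahlfors-Bowen property, and on each of them
    the weak Bowen condition forces [exp (q X_n)] to be at least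
    [exp (n (q alpha - e))]. As the integral of [exp (q X_n)] is at most
    [exp (n r)], the separated set has at most
    [C * exp (n (h - alpha q + r + e))] points ([size_separated_le]).

    By maximality the full-radius balls around these points cover [A_n], and
    every point of the level set lies in [A_n] for all large [n]. So, for
    every [N], the balls of all orders [n >= N] together cover the level set,
    and their total weight at [t > h - alpha q + r + e] is at most the
    tail of a convergent geometric series: Bowen's outer measure at [t]
    vanishes ([htop_eps_le_growth]). Letting [e] and [eps] tend to [0], then
    [r] to the free energy, bounds the entropy of the level set by
    [h - (alpha q - phi q)]; the infimum over [q] is the theorem. *)

(** * Bowen metrics and separated sets *)

Section bowen_metric.
Context {R : realType} {Omega : metricType R} (T : Omega -> Omega).
Implicit Types (x y z : Omega) (A : set Omega) (eps : R) (n : nat).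

Lemma bowen_dist_leP n x y c : 0 <= c ->
  (bowen_dist T n x y <= c) <->
  (forall i, (i < n)%N -> mdist (iter i T x) (iter i T y) <= c).
Proof.
move=> c0; split=> [+ i iltn|h]; last first.
  by apply: bigmax_le => // i _; exact: h.
apply: le_trans.
exact: (@le_bigmax_seq _ _ _ _ _ (Ordinal iltn) xpredT
  (fun i : 'I_n => mdist (iter i T x) (iter i T y)) (mem_index_enum _) isT).
Qed.

Lemma bowen_dist_ge0 n x y : 0 <= bowen_dist T n x y.
Proof. exact: bigmax_ge_id. Qed.

Lemma mdist_le_bowen_dist n i x y : (i < n)%N ->
  mdist (iter i T x) (iter i T y) <= bowen_dist T n x y.
Proof. by move: i; apply/bowen_dist_leP => //; exact: bowen_dist_ge0. Qed.

Lemma bowen_distxx n x : bowen_dist T n x x = 0.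
Proof.
apply/eqP; rewrite eq_le bowen_dist_ge0 andbT.
by apply/bowen_dist_leP => // i _; rewrite mdistxx.
Qed.

Lemma bowen_distC n x y : bowen_dist T n x y = bowen_dist T n y x.
Proof. by apply: eq_bigr => i _; rewrite metric_sym. Qed.

Lemma bowen_dist_triangle n x y z :
  bowen_dist T n x z <= bowen_dist T n x y + bowen_dist T n y z.
Proof.
apply/bowen_dist_leP => [|i iltn]; first by rewrite addr_ge0// bowen_dist_ge0.
apply: (le_trans (metric_triangle _ (iter i T y) _)).
by rewrite lerD// mdist_le_bowen_dist.
Qed.

Lemma open_mdist_ball x (r : R) : open [set y | mdist x y < r].
Proof.
rewrite openE => y /= xyr; apply/nbhs_ballP.
exists (r - mdist x y) => /=; first by rewrite subr_gt0.
rewrite ballEmdist => z /= yz; apply: (le_lt_trans (metric_triangle x y z)).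
by rewrite -ltrBrDl.
Qed.

(** Unfolding an orbit at its start, not at its end: balls of order [n.+1] are
    then obtained from balls of order [n] by a single preimage under [T]. *)
Lemma bowen_distS n x y :
  bowen_dist T n.+1 x y = Num.max (mdist x y) (bowen_dist T n (T x) (T y)).
Proof.
rewrite /bowen_dist big_ord_recl; congr Num.max.
by apply: eq_bigr => i _; rewrite -!iterSr.
Qed.

Lemma open_bowen_ball n x eps : continuous T -> open (bowen_ball T n x eps).
Proof.
move=> cT; elim: n x => [|n IHn] x.
  rewrite (_ : bowen_ball T 0 x eps = [set _ | 0 < eps]).
    case: (ltP 0 eps) => _.
      by rewrite (_ : mkset _ = setT) ?predeqE//; exact: openT.
    by rewrite (_ : mkset _ = set0) ?predeqE//; exact: open0.
  by apply/seteqP; split=> y; rewrite /bowen_ball/= /bowen_dist big_ord0.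
rewrite (_ : bowen_ball T n.+1 x eps =
    [set y | mdist x y < eps] `&` T @^-1` bowen_ball T n (T x) eps); last first.
  by apply/seteqP; split=> y; rewrite /bowen_ball/= bowen_distS gt_max => /andP.
apply: openI; first exact: open_mdist_ball.
by apply: open_comp => // y _; exact: cT.
Qed.

Definition separated n eps (s : seq Omega) : bool :=
  pairwise (fun x y => eps <= bowen_dist T n x y) s.

Lemma separated_uniq n eps s : 0 < eps -> separated n eps s -> uniq s.
Proof.
move=> eps0; apply: pairwise_uniq => x.
by rewrite bowen_distxx leNgt eps0.
Qed.

Lemma separated_in n eps s x y : separated n eps s ->
  x \in s -> y \in s -> x != y -> eps <= bowen_dist T n x y.
Proof.
elim: s => //= a s IHs /andP[/allP sep_a sep_s].
rewrite !inE => /predU1P[->|xs] /predU1P[->|ys] xy.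
- by rewrite eqxx in xy.
- exact: sep_a.
- by rewrite bowen_distC; exact: sep_a.
- exact: IHs.
Qed.

Lemma trivIset_bowen_ball n eps s : separated n eps s ->
  trivIset [set` s] (fun x => bowen_ball T n x (eps / 2)).
Proof.
move=> sep; apply/trivIsetP => x y xs ys xy; rewrite -subset0 => z [xz yz].
have := separated_in sep xs ys xy; apply/negP; rewrite -ltNge.
apply: (le_lt_trans (bowen_dist_triangle n x z y)).
by rewrite [eps]splitr ltrD// bowen_distC.
Qed.

(** A separated set of largest size is maximal, so no point of [A] can stay at
    distance at least [eps] from all its members. *)
Lemma separated_cover n eps A (b : nat) :
  (forall s, separated n eps s -> [set` s] `<=` A -> (size s <= b)%N) ->
  exists s, [/\ separated n eps s, [set` s] `<=` A &
    forall y, A y -> exists2 x, x \in s & bowen_ball T n x eps y].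
Proof.
move=> sb.
pose P k := `[< exists s, [/\ separated n eps s, [set` s] `<=` A & size s = k] >].
have exP : exists k, P k by exists 0%N; apply/asboolP; exists [::].
have Pb k : P k -> (k <= b)%N by move=> /asboolP[s [? ? <-]]; exact: sb.
case: (ex_maxnP exP Pb) => k /asboolP[s [sep sA sk]] kmax.
exists s; split=> // y Ay; apply: contrapT => ny.
have : P k.+1.
  apply/asboolP; exists (rcons s y); split; last by rewrite size_rcons sk.
  - rewrite /separated pairwise_rcons; apply/andP; split=> //.
    apply/allP => x xs /=; rewrite leNgt; apply/negP => xy.
    by apply: ny; exists x.
  - by move=> z /=; rewrite mem_rcons inE => /predU1P[->//|/sA].
by move=> /kmax; rewrite ltnn.
Qed.

End bowen_metric.

(** * Covers of exponential growth *)

Section countable_covers.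
Context {R : realType} {Omega : metricType R} (T : Omega -> Omega).
Local Open Scope card_scope.
Local Open Scope ereal_scope.

(** Covers in the definition of entropy are sequences of balls, so finitely
    many balls of each order [n >= N] have to be enumerated. With every [s n]
    nonempty the family is infinite, hence in bijection with [nat]; padding a
    finite family would add infinite weight when [t <= 0]. *)
Lemma bowen_premeasure_le_tail (Z : set Omega) (t eps : R) (N : nat)
    (s : nat -> seq Omega) :
  (forall n, (N <= n)%N -> (0 < size (s n))%N) ->
  (forall z, Z z -> exists n, (N <= n)%N /\
     exists2 x, x \in s n & bowen_ball T n x eps z) ->
  bowen_premeasure T Z t eps N <=
  \sum_(N <= n <oo) ((size (s n))%:R * expR (- (n%:R * t)))%:E.
Proof.
move=> s0 Zs; rewrite /bowen_premeasure; case: asboolP => [_|/eqP/set0P[x0 _]].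
  by apply: nneseries_ge0 => n _ _; rewrite lee_fin mulr_ge0// expR_ge0.
(* the pair [(n, j)] stands for the ball around the [j]-th point of [s n] *)
pose K := [set n : nat | (N <= n)%N].
pose J n := `I_(size (s n)).
pose D := K `*`` J.
have infD : infinite_set D.
  move=> /(finite_image fst) finK; apply: infinite_nat.
  apply: (@sub_finite_set _ _ (fst @` D `|` `I_N)).
    move=> n _; have [nN|Nn] := ltnP n N; first by right.
    by left; exists (n, 0%N) => //; split=> //; exact: s0.
  by rewrite finite_setU.
have /card_set_bijP[f bijf] : [set: nat] #= D.
  apply/card_eqPle; split; first exact/infiniteP.
  exact: countableP.
have fD i : D (f i) by have [fD _ _] := bijf; exact: fD.
apply: ereal_inf_lbound; exists (fun i => (f i).1), (fun i => nth x0 (s (f i).1) (f i).2).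
split.
  split=> [i|z /Zs[n [Nn [x xs xz]]]]; first by have [] := fD i.
  have [_ _ /(_ (n, index x (s n)))] := bijf.
  case=> [|i _ fi]; first by split=> //=; rewrite /J/= index_mem.
  by exists i => //; rewrite fi /= nth_index.
rewrite [RHS]nneseries_esumT; last by move=> n; rewrite lee_fin expR_ge0.
rewrite -(@reindex_esum _ _ _ setT D f (fun p => (expR (- (p.1%:R * t)))%:E) bijf).
rewrite -(@esum_esum _ _ _ K J (fun n _ => (expR (- (n%:R * t)))%:E)).
  rewrite [LHS]eseries_cond nneseries_esum => [|n _]; last first.
    by rewrite lee_fin mulr_ge0// expR_ge0.
  apply: eq_esum => n _.
  rewrite esum_fset; [|exact: finite_II|by move=> *; rewrite lee_fin expR_ge0].
  by rewrite -fsbig_ord sumEFin sumr_const card_ord mulr_natl.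
by move=> n j _ _; rewrite lee_fin expR_ge0.
Qed.

Lemma geometric_eseries_lty (a z : R) : (`|z| < 1)%R ->
  \sum_(n <oo) (a * z ^+ n)%:E < +oo.
Proof.
move=> z1; rewrite (_ : (fun n => _) = EFin \o series (geometric a z)).
  by rewrite EFin_lim ?ltry//; exact: is_cvg_geometric_series.
by apply/funext => n /=; rewrite sumEFin.
Qed.

(** Each point need only be covered from some order on, and this order may
    depend on the point: balls of all orders [n >= N] are used at once. *)
Lemma htop_eps_le_growth (Z : set Omega) (eps c C : R) (s : nat -> seq Omega) :
  Z !=set0 -> (0 <= C)%R ->
  (forall z, Z z ->
     \forall n \near \oo, exists2 x, x \in s n & bowen_ball T n x eps z) ->
  (\forall n \near \oo, ((size (s n))%:R <= C * expR (n%:R * c))%R) ->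
  htop_eps T Z eps <= c%:E.
Proof.
move=> [z0 Zz0] C0 Zs sC; apply/lee_addgt0Pr => d d0; rewrite -EFinD.
apply: ereal_inf_lbound; exists (c + d)%R => //=.
pose g n := (C * expR (- d) ^+ n)%:E.
have g0 n : 0 <= g n by rewrite lee_fin mulr_ge0// exprn_ge0// expR_ge0.
apply/cvg_lim => //.
apply: (@squeeze_cvge _ _ _ _ (cst 0) _ (fun N => \sum_(N <= n <oo) g n)).
(* a single point of [Z] already forces [s n] to be nonempty for large [n] *)
- have [M1 _ s_gt0] : \forall n \near \oo, (0 < size (s n))%N.
    by apply: filterS (Zs _ Zz0) => n [x]; case: (s n).
  have [M2 _ sizes] := sC.
  exists (maxn M1 M2) => // N /=; rewrite geq_max => /andP[M1N M2N].
  rewrite bowen_premeasure_ge0/=.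
  apply: (le_trans (@bowen_premeasure_le_tail Z _ eps N s _ _)).
  + by move=> n Nn; apply: s_gt0; exact: leq_trans Nn.
  + move=> z /Zs[M _ zs]; exists (maxn N M); split; first exact: leq_maxl.
    by apply: zs; exact: leq_maxr.
  + rewrite eseries_cond [leRHS]eseries_cond; apply: lee_nneseries => n.
      by rewrite lee_fin mulr_ge0// expR_ge0.
    rewrite /= => Nn; rewrite lee_fin.
    have -> : (expR (- d) ^+ n = expR (n%:R * c) * expR (- (n%:R * (c + d))))%R.
      by rewrite -expRM_natl -expRD; congr expR; ring.
    rewrite mulrA ler_wpM2r ?expR_ge0//; apply: sizes.
    exact: leq_trans Nn.
- exact: cvg_cst.
- apply: nneseries_tail_cvg => [|n _]; last exact: g0.
  apply: geometric_eseries_lty.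
  by rewrite ger0_norm ?expR_ge0// expR_lt1 oppr_lt0.
Qed.

End countable_covers.

(** * Packing estimate *)

Section packing.
Context {R : realType} {Omega : pointedMetricType R} (T : Omega -> Omega).
Context (nu : probability (borel Omega) R).
Local Open Scope ereal_scope.

Lemma measurable_bowen_ball n (x : Omega) (eps : R) :
  continuous T -> measurable (bowen_ball T n x eps : set (borel Omega)).
Proof. by move=> cT; apply: sub_sigma_algebra; exact: open_bowen_ball. Qed.

(** Balls of radius [eps / 2] around the points of [s] are disjoint by the
    triangle inequality, so their contributions to the integral add up. *)
Lemma separated_integral_ge n (eps : R) (s : seq Omega)
    (f : borel Omega -> \bar R) (m p : R) :
  continuous T -> (0 < eps)%R -> separated T n eps s -> measurable_fun setT f ->
  (forall y, 0 <= f y) -> (0 <= m)%R ->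
  (forall x y, x \in s -> bowen_ball T n x (eps / 2) y -> m%:E <= f y) ->
  (forall x, p%:E <= nu (bowen_ball T n x (eps / 2))) ->
  ((size s)%:R * (m * p))%:E <= \int[nu]_y f y.
Proof.
move=> cT eps0 sep mf f0 m0 fm nup.
pose B (x : Omega) : set (borel Omega) := bowen_ball T n x (eps / 2).
have mB x : measurable (B x) by exact: measurable_bowen_ball.
pose D : set (borel Omega) := \big[setU/set0]_(x <- s) B x.
have mD : measurable D by exact: bigsetU_measurable.
apply: (@le_trans _ _ (\int[nu]_(y in D) f y)); last first.
  by apply: ge0_subset_integral.
rewrite ge0_integral_bigsetU//; first last.
- exact: measurable_funS mf.
- exact: trivIset_bowen_ball.
- exact: separated_uniq sep.
apply: (@le_trans _ _ (\sum_(x <- s) (m * p)%:E)).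
  by rewrite sumEFin big_const_seq count_predT iter_addr addr0 mulr_natl.
rewrite big_seq [leRHS]big_seq; apply: lee_sum => x xs.
apply: (@le_trans _ _ (\int[nu]_(y in B x) m%:E)).
  rewrite integral_cst//= EFinM.
  by apply: lee_wpmul2l; rewrite ?lee_fin//; exact: nup.
apply: ge0_le_integral => //.
- exact: measurable_funS mf.
- by move=> y; exact: fm.
Qed.

End packing.

(** * Level sets *)

Section level_sets.
Context {R : realType} {Omega : pointedMetricType R} (T : Omega -> Omega).
Context (nu : probability (borel Omega) R) (X : nat -> {RV nu >-> R}).
Local Open Scope ereal_scope.

Lemma free_energy_lt_near q (r : R) : free_energy nu X q < r%:E ->
  \forall n \near \oo,
    \int[nu]_x (expR (q * X n x))%:E <= (expR (n%:R * r))%:E.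
Proof.
move=> /ereal_inf_ltP[_ [V Voo <-] Vr].
near=> n.
have n0 : (0 < n%:R :> R)%R by rewrite ltr0n; near: n; exact: nbhs_infty_gt.
set I := \int[nu]_x _.
have I0 : 0 <= I by apply: integral_ge0 => x _; rewrite lee_fin expR_ge0.
have : n%:R^-1%:E * lne I < r%:E.
  apply: le_lt_trans Vr; apply: ereal_sup_ubound; exists n => //.
  by near: n; exact: Voo.
rewrite lte_pdivrMl// -EFinM => Ir.
have -> : (expR (n%:R * r))%:E = expeR (n%:R * r)%:E by [].
rewrite -[I]lneK; last by rewrite in_itv/= I0 leey.
by rewrite lee_expeR ltW.
Unshelve. all: by end_near. Qed.

Lemma variation_near (delta eta : R) : (0 < eta)%R ->
  (n%:R^-1%:E * Defs.variation T n delta (X n)) @[n --> \oo] --> (0 : \bar R) ->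
  \forall n \near \oo, forall y z, (bowen_dist T n y z <= delta)%R ->
    (`|X n y - X n z| <= n%:R * eta)%R.
Proof.
move=> eta0 /fine_cvgP[fin cvgv]; near=> n => y z yz.
have n0 : (0 < n%:R :> R)%R by rewrite ltr0n; near: n; exact: nbhs_infty_gt.
rewrite -lee_fin EFinM; apply: (@le_trans _ _ (Defs.variation T n delta (X n))).
  by apply: ereal_sup_ubound; exists y, z.
rewrite -lee_pdivrMl//.
have fn : n%:R^-1%:E * Defs.variation T n delta (X n) \is a fin_num by near: n.
rewrite -(fineK fn) lee_fin ltW//.
by near: n; exact: cvgr_lt cvgv _ eta0.
Unshelve. all: by end_near. Qed.

Lemma level_set_near alpha (eta : R) x : (0 < eta)%R -> level_set X alpha x ->
  \forall n \near \oo, (`|X n x - n%:R * alpha| <= n%:R * eta)%R.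
Proof.
move=> eta0 /cvgrPdist_le/(_ _ eta0) cvgx; near=> n.
have n0 : (0 < n%:R :> R)%R by rewrite ltr0n; near: n; exact: nbhs_infty_gt.
have -> : (X n x - n%:R * alpha = - (n%:R * (alpha - n%:R^-1 * X n x)))%R.
  by field; rewrite gt_eqF.
rewrite normrN normrM gtr0_norm// ler_pM2l//.
by near: n.
Unshelve. all: by end_near. Qed.

(** Moving [x] to [y] inside a Bowen ball and replacing [X n x] by [n * alpha]
    each cost at most [n * eta] in [X n y]; hence the factor [2]. *)
Lemma tilt_ge (q alpha eta e : R) n x y : (2 * `|q| * eta <= e)%R ->
  (`|X n x - n%:R * alpha| <= n%:R * eta)%R ->
  (`|X n y - X n x| <= n%:R * eta)%R ->
  (n%:R * (alpha * q - e) <= q * X n y)%R.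
Proof.
move=> eta_e Ax yx.
have : (`|q * X n y - n%:R * (alpha * q)| <= n%:R * e)%R.
  have -> : (q * X n y - n%:R * (alpha * q) =
    q * ((X n y - X n x) + (X n x - n%:R * alpha)))%R by ring.
  rewrite normrM; apply: (@le_trans _ _ (`|q| * (n%:R * eta + n%:R * eta)))%R.
    by rewrite ler_wpM2l// (le_trans (ler_normD _ _))// lerD.
  have -> : (`|q| * (n%:R * eta + n%:R * eta) = n%:R * (2 * `|q| * eta))%R.
    by ring.
  by rewrite ler_wpM2l.
by rewrite ler_norml => /andP[+ _]; lra.
Qed.

(** An exponential Chebyshev bound: the integral of [expR (q * X n)], at most
    [expR (n%:R * r)], is shared among disjoint balls which each contribute at
    least [expR (n%:R * (alpha * q - e)) * (C^-1 * expR (- (n%:R * h)))]. *)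
Lemma size_separated_le (h alpha q r e eps delta eta C : R) :
  continuous T -> (0 < C)%R -> (0 < eps <= delta)%R -> (0 < eta)%R ->
  (2 * `|q| * eta <= e)%R ->
  (forall n w, (1 <= n)%N ->
    (C^-1 * expR (- (n%:R * h)))%:E <= nu (bowen_ball T n w (eps / 2))) ->
  (n%:R^-1%:E * Defs.variation T n delta (X n)) @[n --> \oo] --> (0 : \bar R) ->
  free_energy nu X q < r%:E ->
  \forall n \near \oo, forall s, separated T n eps s ->
    (forall x, x \in s -> (`|X n x - n%:R * alpha| <= n%:R * eta)%R) ->
    ((size s)%:R <= C * expR (n%:R * (h - alpha * q + r + e)))%R.
Proof.
move=> cT C0 /andP[eps0 eps_delta] eta0 eta_e ahl var phir.
have intn := free_energy_lt_near phir; have varn := variation_near eta0 var.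
near=> n => s sep sA.
have n1 : (1 <= n)%N by near: n; exact: nbhs_infty_gt.
have intle : \int[nu]_x (expR (q * X n x))%:E <= (expR (n%:R * r))%:E.
  by near: n.
have varle : forall y z, (bowen_dist T n y z <= delta)%R ->
  (`|X n y - X n z| <= n%:R * eta)%R by near: n.
have : ((size s)%:R * (expR (n%:R * (alpha * q - e)) *
    (C^-1 * expR (- (n%:R * h)))))%:E <= (expR (n%:R * r))%:E.
  apply: le_trans intle; apply: (separated_integral_ge cT eps0 sep).
  - apply/measurable_EFinP; apply: measurableT_comp => //.
    exact: measurable_funM.
  - by move=> y; rewrite lee_fin expR_ge0.
  - exact: expR_ge0.
  - move=> x y xs xy; rewrite lee_fin ler_expR.
    apply: (tilt_ge eta_e (sA x xs)).
    apply: varle; rewrite bowen_distC ltW// (lt_le_trans xy)//.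
    by rewrite (le_trans _ eps_delta)// ler_pdivrMr// ler_peMr ?ltW// ltr1n.
  - by move=> x; exact: ahl.
rewrite lee_fin; set u := (n%:R * (alpha * q - e))%R; set v := (n%:R * h)%R.
move=> sizeE.
have -> : (C * expR (n%:R * (h - alpha * q + r + e)) =
    expR (n%:R * r) * (C * expR (- u) * expR v))%R.
  have -> : (n%:R * (h - alpha * q + r + e) = n%:R * r - u + v)%R.
    by rewrite /u /v; ring.
  by rewrite !expRD; ring.
rewrite -ler_pdivrMr ?mulr_gt0 ?expR_gt0//; apply: le_trans sizeE.
by rewrite !invfM -!expRN opprK le_eqVlt; apply/orP; left; apply/eqP; ring.
Unshelve. all: by end_near. Qed.

Lemma htop_eps_level_set_le (h alpha q r e eps delta : R) :
  continuous T -> ahlfors_bowen T nu h ->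
  (n%:R^-1%:E * Defs.variation T n delta (X n)) @[n --> \oo] --> (0 : \bar R) ->
  level_set X alpha !=set0 -> free_energy nu X q < r%:E -> (0 < e)%R ->
  (0 < eps <= delta)%R ->
  htop_eps T (level_set X alpha) eps <= (h - alpha * q + r + e)%:E.
Proof.
move=> cT [_ /(_ (eps / 2)%R)] ahl var K0 phir e0 eps_delta.
have eps2 : (0 < eps / 2)%R by case/andP: eps_delta => eps0 _; rewrite divr_gt0.
have [C C0 {}ahl] := ahl eps2.
(* the [+ 1] keeps the denominator positive when [q = 0] *)
pose eta := (e / (2 * (`|q| + 1)))%R.
have q1 : (0 < 2 * (`|q| + 1))%R by rewrite mulr_gt0// ltr_wpDl.
have eta0 : (0 < eta)%R by rewrite divr_gt0.
have eta_e : (2 * `|q| * eta <= e)%R.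
  rewrite /eta mulrA ler_pdivrMr// mulrC ler_pM2l// mulrDr mulr1.
  by rewrite lerDl.
pose A n : set Omega := [set x | (`|X n x - n%:R * alpha| <= n%:R * eta)%R].
pose c := (h - alpha * q + r + e)%R.
have size_le := @size_separated_le h alpha q r e eps delta eta C cT C0 eps_delta eta0 eta_e
  (fun n w n1 => (ahl n w n1).1) var phir.
have [s sP] : exists s : nat -> seq Omega, \forall n \near \oo,
    [/\ separated T n eps (s n), [set` s n] `<=` A n &
    forall y, A n y -> exists2 x, x \in s n & bowen_ball T n x eps y].
  case: size_le => M _ size_le.
  have /choice[s sP] : forall n, exists s, (M <= n)%N ->
      [/\ separated T n eps s, [set` s] `<=` A n &
      forall y, A n y -> exists2 x, x \in s & bowen_ball T n x eps y].
    move=> n; have [nM|Mn] := ltnP n M; first by exists [::].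
    have [s sep sA|s sP] := @separated_cover _ _ T n eps (A n)
        (Num.truncn (C * expR (n%:R * c))); last by exists s.
    rewrite truncn_ge_nat ?mulr_ge0 ?expR_ge0 ?(ltW C0)//.
    exact: size_le.
  by exists s, M.
apply: (@htop_eps_le_growth _ _ _ _ _ _ C s) => //.
- exact: ltW.
- move=> z Kz; apply: filterS2 (level_set_near eta0 Kz) sP => n Az [_ _].
  exact.
- by apply: filterS2 size_le sP => n sz [sep sA _]; exact: sz.
Qed.

Lemma htop_level_set_le (h alpha q r : R) :
  continuous T -> ahlfors_bowen T nu h -> weak_bowen T X ->
  level_set X alpha !=set0 -> free_energy nu X q < r%:E ->
  htop T (level_set X alpha) <= (h - alpha * q + r)%:E.
Proof.
move=> cT ahl [delta delta0 var] K0 phir; apply/lee_addgt0Pr => e e0.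
rewrite -EFinD; apply: lime_le; first exact: is_cvg_htop_eps.
near=> eps; apply: htop_eps_level_set_le var K0 phir e0 _ => //.
apply/andP; split; near: eps; first exact: nbhs_right_gt.
exact: nbhs_right_le.
Unshelve. all: by end_near. Qed.

End level_sets.

Unset Implicit Arguments.

Theorem theoremB (R : realType) (Omega : pointedMetricType R)
    (T : Omega -> Omega) (nu : probability (borel Omega) R)
    (X : nat -> {RV nu >-> R}) :
  compact [set: Omega] ->
  continuous T ->
  (htop T [set: Omega] < +oo)%E ->
  ahlfors_bowen T nu (fine (htop T [set: Omega])) ->
  weak_bowen T X ->
  forall alpha : R, spectrum X alpha ->
    (htop T (level_set X alpha) <=
     htop T [set: Omega] - legendre (free_energy nu X) alpha)%E.
Proof.
move=> _ cT hoo ahl wb alpha K0.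
(* [fine -oo = 0], so positivity of the Ahlfors parameter excludes [-oo] *)
have [h hE] : exists h : R, htop T [set: Omega] = h%:E.
  case: ahl hoo => + _; case: (htop T [set: Omega]) => //= [h _ _|].
    by exists h.
  by rewrite ltxx.
rewrite hE /= in ahl *.
rewrite addeC -leeBlDr// leeNr; apply: ge_ereal_sup => _ [q _ <-].
rewrite leeNr leeBlDr//.
have bound (r : R) := @htop_level_set_le _ _ T nu X h alpha q r cT ahl wb K0.
case: (free_energy nu X q) bound => [p| |] bound.
- apply/lee_addgt0Pr => e e0.
  rewrite -EFinB -EFinN -!EFinD.
  have -> : - (alpha * q - p) + h + e = h - alpha * q + (p + e) by ring.
  by apply: bound; rewrite lte_fin ltrDl.
- by rewrite leey.
(* here [r] ranges over all reals, so the entropy is below every real *)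
- move: bound; case: (htop T (level_set X alpha)) => [w| |] //= bound.
  + have := bound (w - 1 - h + alpha * q) (ltNyr _).
    have -> : h - alpha * q + (w - 1 - h + alpha * q) = w - 1 by ring.
    by rewrite lee_fin leNgt ltrBlDr ltrDl ltr01.
  + by have := bound 0 (ltNyr _).
Qed.
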